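(* Let $(A,[\cdot,\cdot],\rho)$ be a Lie algebroid over a smooth manifold $M$ and let $\Pi\in\Gamma(\wedge^nA)$, $n\ge 2$, be a locally decomposable $n$-multisection of $A$. Then the following conditions are equivalent: (1) $\mathcal L_{\Pi^\sharp\alpha}\Pi=(-1)^n(\iota_{d_A\alpha}\Pi)\,\Pi$ for all $\alpha\in\Gamma(\wedge^{n-1}A^* )$; (2) $[\Pi^\sharp\alpha,\Pi]^\sharp(\beta)=-\Pi^\sharp(\iota_{\Pi^\sharp\beta}d_A\alpha)$ for all $\alpha,\beta\in\Gamma(\wedge^{n-1}A^* )$.
   Context: $d_A$ is the Lie algebroid differential on $\Gamma(\wedge^\bullet A^* )$. $[\cdot,\cdot]$ also denotes the Schouten bracket on $\Gamma(\wedge^\bullet A)$, and for $X\in\Gamma A$, $P\in\Gamma(\wedge^\bullet A)$, $\mathcal L_XP=[X,P]$ (the degree-zero derivation of the wedge product with $[X,f]=\rho(X)f$ on functions and $[X,Y]$ the Lie algebroid bracket on sections). Contractions: multisections are evaluated by $P(\alpha_1\wedge\cdots\wedge\alpha_k)=P(\alpha_1,\dots,\alpha_k)$, with $(X_1\wedge\cdots\wedge X_k)(\alpha_1,\dots,\alpha_k)=\det(\alpha_i(X_j))$. For $\alpha\in\Gamma A^*$, $(\iota_\alpha P)(\beta)=P(\alpha\wedge\beta)$, and $\iota_{\alpha_1\wedge\cdots\wedge\alpha_k}=\iota_{\alpha_k}\circ\cdots\circ\iota_{\alpha_1}$, extended $C^\infty(M)$-linearly to $\iota_\eta P$ for $\eta\in\Gamma(\wedge^kA^*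 )$. For $X\in\Gamma A$, $\iota_X$ on forms is insertion in the first slot. For $P\in\Gamma(\wedge^nA)$, $P^\sharp:\Gamma(\wedge^{n-1}A^* )\to\Gamma A$ is $P^\sharp(\alpha)=\iota_\alpha P$. $\Pi\in\Gamma(\wedge^nA)$ is locally decomposable if for each $x\in M$ either $\Pi(x)=0$ or there are a neighbourhood $U$ of $x$ and local sections $X_1,\dots,X_n$ of $A$ over $U$ with $\Pi|_U=X_1\wedge\cdots\wedge X_n$. *)

(* Defs.v *)
From HB Require Import structures.
From mathcomp Require Import all_boot all_order all_algebra all_fingroup.
From mathcomp Require Import all_classical all_reals all_analysis.
Import Order.TTheory GRing.Theory Num.Theory.
Import numFieldNormedType.Exports.

Set Implicit Arguments.
Unset Strict Implicit.
Unset Printing Implicit Defensive.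

Local Open Scope classical_set_scope.
Local Open Scope ring_scope.

(** * Definite description *)

(* The element characterized by [P], when there is one; [d] is a junk value. *)
Definition the_or (T : Type) (d : T) (P : T -> Prop) : T :=
  if pselect (exists t, P t) is left h then projT1 (cid h) else d.

(** * Smooth functions on open subsets of R^m *)

(* C^k through iterated partial derivatives: on an open set this is the usual
   notion, since all the partial derivatives up to order k are continuous. *)
Fixpoint Ck (R : realType) (m k : nat) (U : set 'rV[R]_m) (f : 'rV[R]_m -> R)
    : Prop :=
  (forall y, U y -> {for y, continuous f}) /\
  match k with
  | 0 => True
  | k'.+1 => forall i : 'I_m,
      (forall y, U y -> derivable f y (delta_mx 0 i)) /\
      Ck k' U ('D_(delta_mx 0 i) f)
  end.

Definition Cinf (R : realType) (m : nat) (U : set 'rV[R]_m)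
  (f : 'rV[R]_m -> R) : Prop := forall k, Ck k U f.

(** * Smooth manifolds *)

(* [chart_map] and [chart_inv] are only meaningful on [chart_dom] and
   [chart_cod]. *)
Record chart (R : realType) (m : nat) (M : topologicalType) := Chart {
  chart_dom : set M;
  chart_cod : set 'rV[R]_m;
  chart_map : M -> 'rV[R]_m;
  chart_inv : 'rV[R]_m -> M;
  chart_dom_open : open chart_dom;
  chart_cod_open : open chart_cod;
  chart_map_cod : forall x, chart_dom x -> chart_cod (chart_map x);
  chart_inv_dom : forall y, chart_cod y -> chart_dom (chart_inv y);
  chart_mapK : forall x, chart_dom x -> chart_inv (chart_map x) = x;
  chart_invK : forall y, chart_cod y -> chart_map (chart_inv y) = y;
  chart_map_cont : forall x, chart_dom x -> {for x, continuous chart_map};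
  chart_inv_cont : forall y, chart_cod y -> {for y, continuous chart_inv}
}.

Record manifold (R : realType) (m : nat) := Manifold {
  manifold_space :> topologicalType;
  manifold_hausdorff : hausdorff_space manifold_space;
  manifold_second_countable : @second_countable manifold_space;
  atlas : set (chart R m manifold_space);
  atlas_cover : forall x, exists2 c, atlas c & chart_dom c x;
  atlas_compat : forall c d, atlas c -> atlas d -> forall i : 'I_m,
    Cinf [set y | chart_cod c y /\ chart_dom d (chart_inv c y)]
         (fun y => chart_map d (chart_inv c y) 0 i)
}.

Definition smooth_on (R : realType) (m : nat) (M : manifold R m) (W : set M)
    (f : M -> R) : Prop :=
  forall c, atlas c ->
    Cinf [set y | chart_cod c y /\ W (chart_inv c y)]
         (fun y => f (chart_inv c y)).

Definition smooth (R : realType) (m : nat) (M : manifold R m) (f : M -> R) :=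
  smooth_on setT f.

(* Tangent vectors at [x] are the derivations at [x] of the algebra of smooth
   functions; [v] is unconstrained on functions that are not smooth. *)
Definition tangent_vector (R : realType) (m : nat) (M : manifold R m) (x : M)
    (v : (M -> R) -> R) : Prop :=
  (forall (a : R) (f g : M -> R), smooth f -> smooth g ->
     v (fun y => a * f y + g y) = a * v f + v g) /\
  (forall f g : M -> R, smooth f -> smooth g ->
     v (fun y => f y * g y) = f x * v g + v f * g x).

(** * Vector bundles *)

Record local_frame (R : realType) (m r : nat) (M : manifold R m)
    (F : M -> vectType R) := LocalFrame {
  frame_dom : set M;
  frame :> forall x, r.-tuple (F x)
}.

(* A vector bundle of rank r: a family of vector spaces, with a cover by local
   frames (i.e. local trivializations) whose transition matrices are smooth. *)
Record vector_bundle (R : realType) (m : nat) (M : manifold R m) (r : nat) :=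
    VectorBundle {
  fibre :> M -> vectType R;
  frames : set (local_frame r fibre);
  frame_open : forall e, frames e -> open (frame_dom e);
  frame_basis : forall e, frames e ->
    forall x, frame_dom e x -> basis_of fullv (e x);
  frame_cover : forall x, exists2 e, frames e & frame_dom e x;
  frame_compat : forall e e', frames e -> frames e' -> forall i j : 'I_r,
    smooth_on (frame_dom e `&` frame_dom e')
              (fun x => coord (e x) i (tnth (e' x) j))
}.

Definition dual (R : realType) (V : vectType R) : vectType R := 'Hom(V, R^o).

Definition coframe (R : realType) (V : vectType R) (r : nat)
  (e : r.-tuple V) (i : 'I_r) : dual V := linfun (coord e i : V -> R^o).

Section Sections.
Variables (R : realType) (m r : nat) (M : manifold R m).
Variable A : vector_bundle M r.

Definition section := forall x : M, A x.

Definition smooth_section_on (W : set M) (s : section) : Prop :=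
  forall e, frames e -> forall i : 'I_r,
    smooth_on (W `&` frame_dom e) (fun x => coord (e x) i (s x)).

Definition smooth_section := smooth_section_on setT.

End Sections.

(** * Exterior powers *)

Definition update (k : nat) (T : Type) (b : 'I_k -> T) (i : 'I_k) (u : T) :
  'I_k -> T := fun j => if j == i then u else b j.

(* The k-th exterior power of V^* is the space of alternating k-linear maps on
   V, and the k-th exterior power of V is that of the alternating k-linear maps
   on V^*. *)
Definition alternating (R : realType) (V : vectType R) (k : nat)
    (w : ('I_k -> V) -> R) : Prop :=
  (forall (b : 'I_k -> V) (i : 'I_k) (a : R) (u v : V),
     w (update b i (a *: u + v)) = a * w (update b i u) + w (update b i v)) /\
  (forall (b : 'I_k -> V) (i j : 'I_k), i != j -> b i = b j -> w b = 0).

(* The arguments (a_1, ..., a_k, b_1, ..., b_l).  The order of the sum makes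
   [1 + k] and [0 + k] convertible to [k.+1] and [k]. *)
Definition args_cat (T : Type) (l k : nat) (a : 'I_k -> T) (b : 'I_l -> T) :
    'I_(l + k) -> T :=
  fun i => match fintype.split (cast_ord (addnC l k) i) with
           | inl j => a j
           | inr j => b j
           end.

Definition args_cons (T : Type) (k : nat) (a : T) (b : 'I_k -> T) :
    'I_k.+1 -> T :=
  fun i => if unlift ord0 i is Some j then b j else a.

Section Exterior.
Variables (R : realType) (V : vectType R).

(* The decomposable form a_1 ^ ... ^ a_k. *)
Definition decomposable_form (k : nat) (a : 'I_k -> dual V) :
  ('I_k -> V) -> R := fun X => \det (\matrix_(i, j) a i (X j)).

(* The decomposable multivector X_1 ^ ... ^ X_k. *)
Definition decomposable_vec (k : nat) (X : 'I_k -> V) :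
  ('I_k -> dual V) -> R := fun a => \det (\matrix_(i, j) a i (X j)).

Definition wedge (k l : nat) (P : ('I_k -> dual V) -> R)
    (Q : ('I_l -> dual V) -> R) : ('I_(k + l) -> dual V) -> R :=
  fun a => (k`!%:R * l`!%:R)^-1 *
    \sum_(s : 'S_(k + l)) (-1) ^+ s *
      P (fun i => a (s (lshift l i))) * Q (fun j => a (s (rshift k j))).

(* The contraction i_eta P of a multivector by a k-form.  Expanding
   eta = 1/k! \sum_i eta(e_i1, ..., e_ik) e^i1 ^ ... ^ e^ik in a basis, this is
   the linear extension of
   (i_(a_1 ^ ... ^ a_k) P)(b_1, ..., b_l) = P(a_1, ..., a_k, b_1, ..., b_l);
   see [contract_decomposable]. *)
Definition contract (l k : nat) (eta : ('I_k -> V) -> R)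
    (P : ('I_(l + k) -> dual V) -> R) : ('I_l -> dual V) -> R :=
  let e := vbasis {:V} in
  fun b => k`!%:R^-1 *
    \sum_(i : {ffun 'I_k -> 'I_(\dim {:V})})
      eta (fun a => tnth e (i a)) * P (args_cat (fun a => coframe e (i a)) b).

(* The contraction of a k-vector by a k-form, as a scalar. *)
Definition full_contract (k : nat) (eta : ('I_k -> V) -> R)
    (P : ('I_k -> dual V) -> R) : R :=
  contract (l := 0) eta P (fun=> 0).

(* The identification of the first exterior power of V (linear maps on V^* )
   with V; see [vec_ofE]. *)
Definition vec_of (P : ('I_1 -> dual V) -> R) : V :=
  let e := vbasis {:V} in
  \sum_(i < \dim {:V}) P (fun=> coframe e i) *: tnth e i.

(* Insertion in the first slot. *)
Definition insert (k : nat) (X : V) (w : ('I_k.+1 -> V) -> R) :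
  ('I_k -> V) -> R := fun b => w (args_cons X b).

End Exterior.

(** * Properties of contractions *)

Section ExteriorTheory.
Variable R : realType.

Lemma alternating_cat (V : vectType R) (l k : nat)
    (P : ('I_(l + k) -> V) -> R) (b : 'I_l -> V) :
  alternating P -> alternating (fun a : 'I_k -> V => P (args_cat a b)).
Proof.
move=> [Pl Pa]; pose emb (i : 'I_k) := cast_ord (addnC k l) (lshift l i).
have embE (a : 'I_k -> V) i : args_cat a b (emb i) = a i.
  rewrite /args_cat /emb cast_ord_comp cast_ord_id.
  by rewrite -[lshift _ _]/(unsplit (inl _)) unsplitK.
have catU (a : 'I_k -> V) i u :
    args_cat (update a i u) b = update (args_cat a b) (emb i) u.
  apply/funext=> j; rewrite /update.
  have [->|ne] := eqVneq j (emb i); first by rewrite embE eqxx.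
  rewrite /args_cat; case: fintype.splitP => // p jp.
  rewrite /=; case: eqP => // pi; case/negP: ne; apply/eqP/val_inj; rewrite /emb /= -pi.
  exact: jp.
split=> [a i c u v|a i j ne aij]; first by rewrite !catU Pl.
apply: (Pa _ (emb i) (emb j)); last by rewrite !embE.
by apply: contraNneq ne => /(congr1 val) /= /val_inj ->.
Qed.

Lemma alternating_update_sum (V : vectType R) (k : nat) (w : ('I_k -> V) -> R)
    (I : Type) (s : seq I) (c : I -> R) (u : I -> V) (b : 'I_k -> V) (i : 'I_k) :
  alternating w ->
  w (update b i (\sum_(j <- s) c j *: u j)) =
  \sum_(j <- s) c j * w (update b i (u j)).
Proof.
move=> [wl _]; elim: s => [|j s IH]; last by rewrite !big_cons wl IH.
rewrite !big_nil; have := wl b i (-1) 0 0.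
by rewrite scaler0 add0r mulN1r addNr.
Qed.

Lemma alternating_tperm (V : vectType R) (k : nat) (w : ('I_k -> V) -> R)
    (b : 'I_k -> V) (i j : 'I_k) :
  alternating w -> i != j -> w (fun p => b (tperm i j p)) = - w b.
Proof.
move=> [wl wa] ne; pose U u v := update (update b i u) j v.
have U2l u u' v : w (U (u + u') v) = w (U u v) + w (U u' v).
  have comm x : U x v = update (update b j v) i x.
    apply/funext=> p; rewrite /U /update.
    by have [->|//] := eqVneq p j; rewrite eq_sym (negbTE ne).
  by rewrite !comm -[u]scale1r wl mul1r scale1r.
have U2r u v v' : w (U u (v + v')) = w (U u v) + w (U u v').
  by rewrite /U -[v]scale1r wl mul1r scale1r.
have U0 u : w (U u u) = 0.
  by apply: (wa _ i j) => //; rewrite /U /update !eqxx (negbTE ne).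
have := U0 (b i + b j); rewrite U2l !U2r !U0 add0r addr0 => /eqP.
rewrite addrC addr_eq0 => /eqP E.
rewrite (_ : (fun p => _) = U (b j) (b i)).
  rewrite E; congr (- w _); apply/funext=> p; rewrite /U /update.
  by have [->|_] := eqVneq p j; last by have [->|_] := eqVneq p i.
apply/funext=> p; rewrite /U /update.
have [->|pj] := eqVneq p j; first by rewrite tpermR.
have [->|pi] := eqVneq p i; first by rewrite tpermL.
by rewrite tpermD // eq_sym.
Qed.

Lemma alternating_perm (V : vectType R) (k : nat) (w : ('I_k -> V) -> R)
    (s : 'S_k) (b : 'I_k -> V) :
  alternating w -> w (fun p => b (s p)) = (-1) ^+ s * w b.
Proof.
move=> wA; have [ts -> dts] := prod_tpermP s.
elim: ts dts b => [|t ts IH] /= dts b.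
  rewrite big_nil odd_perm1 mul1r.
  by congr w; apply/funext=> p; rewrite perm1.
have /andP[dt {}dts] := dts.
rewrite big_cons odd_mul_tperm dt signr_addb mulN1r mulNr -IH //.
rewrite -(alternating_tperm _ wA dt).
by congr w; apply/funext=> p; rewrite permM.
Qed.

Lemma alternating_cons (V : vectType R) (k : nat) (w : ('I_k.+1 -> V) -> R)
    (v : V) : alternating w -> alternating (fun b => w (args_cons v b)).
Proof.
have consU (b : 'I_k -> V) i u :
    args_cons v (update b i u) = update (args_cons v b) (lift ord0 i) u.
  apply/funext=> p; rewrite /args_cons /update.
  case: unliftP => [j|] ->; first by rewrite (inj_eq lift_inj).
  by rewrite eq_liftF.
move=> [wl wa]; split=> [b i a x y|b i j ne bij]; first by rewrite !consU wl.
apply: (wa _ (lift ord0 i) (lift ord0 j)).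
  by rewrite (inj_eq lift_inj).
by rewrite /args_cons !liftK.
Qed.

Lemma alternating_expand (V : vectType R) (k r : nat) (w : ('I_k -> V) -> R)
    (c : 'I_k -> 'I_r -> R) (u : 'I_r -> V) :
  alternating w ->
  w (fun p => \sum_(j < r) c p j *: u j) =
  \sum_(f : {ffun 'I_k -> 'I_r}) (\prod_p c p (f p)) * w (fun p => u (f p)).
Proof.
elim: k w c => [|k IH] w c wA.
  under eq_bigr do rewrite big_ord0 mul1r.
  rewrite (eq_bigr (fun=> w (fun p => \sum_(j < r) c p j *: u j))).
    by rewrite sumr_const card_ffun !card_ord expn0.
  by move=> f _; congr w; apply/funext=> -[].
pose g (q : 'I_r * {ffun 'I_k -> 'I_r}) : {ffun 'I_k.+1 -> 'I_r} :=
  [ffun p => args_cons q.1 q.2 p].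
pose h (f : {ffun 'I_k.+1 -> 'I_r}) : 'I_r * {ffun 'I_k -> 'I_r} :=
  (f ord0, [ffun p => f (lift ord0 p)]).
have g0 q : g q ord0 = q.1 by rewrite ffunE /args_cons unlift_none.
have gS q p : g q (lift ord0 p) = q.2 p by rewrite ffunE /args_cons liftK.
rewrite (reindex g); last first.
  apply: onW_bij; exists h => [[j f]|f].
    by congr pair; [exact: g0|apply/ffunP=> p; rewrite ffunE gS].
  apply/ffunP=> p; case: (unliftP ord0 p) => [q|] ->; first by rewrite gS ffunE.
  by rewrite g0.
transitivity (\sum_j \sum_f (\prod_p c p (g (j, f) p)) *
                w (fun p => u (g (j, f) p))); last first.
  by rewrite pair_bigA; apply: eq_bigr => -[].
pose b p := \sum_(j < r) c p j *: u j.
rewrite (_ : (fun p => _) = update b ord0 (\sum_(j < r) c ord0 j *: u j)).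
  rewrite alternating_update_sum //; apply: eq_bigr => j _.
  rewrite (_ : update b _ _ = args_cons (u j) (fun p => b (lift ord0 p))).
    rewrite (IH _ _ (alternating_cons (u j) wA)) mulr_sumr.
    apply: eq_bigr => f _; rewrite big_ord_recl g0 mulrA; congr (_ * _ * w _).
      by apply: eq_bigr => p _; rewrite gS.
    apply/funext=> p; rewrite /args_cons.
    by case: unliftP => [q|] ->; rewrite ?g0 ?gS.
  apply/funext=> p; rewrite /args_cons /update.
  by case: unliftP => [q|] -> //=.
by apply/funext=> p; rewrite /update; case: eqP => // ->.
Qed.

Lemma coframe_coord (V : vectType R) (b : dual V) :
  b = \sum_i b (tnth (vbasis {:V}) i) *: coframe (vbasis {:V}) i.
Proof.
apply/lfunP=> v; rewrite sum_lfunE {1}(coord_vbasis (memvf v)) linear_sum.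
apply: eq_bigr => i _; rewrite linearZ scale_lfunE lfunE /= -tnth_nth.
exact: mulrC.
Qed.

Lemma contract_decomposable (V : vectType R) (l k : nat)
    (P : ('I_(l + k) -> dual V) -> R) (a : 'I_k -> dual V)
    (b : 'I_l -> dual V) :
  alternating P ->
  contract (decomposable_form a) P b = P (args_cat a b).
Proof.
move=> PA; pose g (c : 'I_k -> dual V) := P (args_cat c b).
have gA : alternating g by exact: alternating_cat.
set e := vbasis {:V}; set d := \dim {:V}.
have ga : g a = \sum_(i : {ffun 'I_k -> 'I_d})
    (\prod_p a p (tnth e (i p))) * g (fun p => coframe e (i p)).
  rewrite -(alternating_expand (fun p i => a p (tnth e i)) (coframe e) gA).
  by congr g; apply/funext=> p; exact: coframe_coord.
rewrite /contract -/e -/d.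
under eq_bigr => i _.
  rewrite /decomposable_form /determinant mulr_suml.
  under eq_bigr do under eq_bigr do rewrite mxE.
  over.
rewrite exchange_big /= (eq_bigr (fun=> g a)) => [|s _].
  by rewrite sumr_const card_Sn -[g a *+ _]mulr_natl mulKf.
rewrite ga (reindex_inj (_ : injective
  (fun i : {ffun 'I_k -> 'I_d} => [ffun p => i (s^-1 p)%g]))) /=; last first.
  move=> i j /ffunP ij; apply/ffunP=> p; have := ij (s p).
  by rewrite !ffunE permK.
apply: eq_bigr => i _.
rewrite (eq_bigr (fun p => a p (tnth e (i p)))); last first.
  by move=> p _; rewrite ffunE permK.
rewrite (_ : (fun p => coframe e ([ffun p0 => i ((s^-1)%g p0)] p)) =
  fun p => (fun q => coframe e (i q)) ((s^-1)%g p)); last first.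
  by apply/funext=> p; rewrite ffunE.
rewrite -/(g (fun p => (fun q => coframe e (i q)) ((s^-1)%g p))).
rewrite alternating_perm // odd_permV mulrCA !mulrA -expr2 sqrr_sign.
by rewrite mul1r.
Qed.

Lemma vec_ofE (V : vectType R) (P : ('I_1 -> dual V) -> R) (b : dual V) :
  alternating P -> b (vec_of P) = P (fun=> b).
Proof.
move=> PA; have U (c : 'I_1 -> dual V) u : update c ord0 u = fun=> u.
  by apply/funext=> p; rewrite /update ord1.
rewrite [in RHS](coframe_coord b) -(U (fun=> 0)).
rewrite (alternating_update_sum _ _ _ _ _ PA) linear_sum.
by apply: eq_bigr => i _; rewrite U linearZ /= mulrC.
Qed.

End ExteriorTheory.

(** * Forms and multisections *)

Section Multi.
Variables (R : realType) (m r : nat) (M : manifold R m).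
Variable A : vector_bundle M r.

(* Possibly non-smooth sections of the tensor bundles; [is_form] and
   [is_multisection] carve out the smooth sections of the exterior powers of
   A^* and A. *)
Definition Aform (k : nat) := forall x : M, ('I_k -> A x) -> R.
Definition multisection (k : nat) := forall x : M, ('I_k -> dual (A x)) -> R.

Definition is_form (k : nat) (w : Aform k) : Prop :=
  (forall x, alternating (w x)) /\
  (forall e, frames e -> forall i : 'I_k -> 'I_r,
     smooth_on (frame_dom e) (fun x => w x (fun a => tnth (e x) (i a)))).

Definition is_multisection (k : nat) (P : multisection k) : Prop :=
  (forall x, alternating (P x)) /\
  (forall e, frames e -> forall i : 'I_k -> 'I_r,
     smooth_on (frame_dom e) (fun x => P x (fun a => coframe (e x) (i a)))).

Definition multi_of_fun (f : M -> R) : multisection 0 := fun x _ => f x.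
Definition multi_of_section (X : section A) : multisection 1 :=
  fun x a => a ord0 (X x).

Definition sharp (k : nat) (P : multisection k.+1) (alpha : Aform k) :
  section A := fun x => vec_of (contract (l := 1) (alpha x) (P x)).

Definition locally_decomposable (k : nat) (P : multisection k) : Prop :=
  forall x : M, (forall a, P x a = 0) \/
    exists (U : set M) (X : 'I_k -> section A),
      [/\ open U, U x, (forall i, smooth_section_on U (X i)) &
          forall y, U y -> forall a,
            P y a = decomposable_vec (fun i => X i y) a].

End Multi.

Arguments multi_of_fun {R m r M} A f x a.
Arguments multi_of_section {R m r M A} X x a.

(** * Lie algebroids *)

(* The anchor A -> TM, as a map to derivations at each point, and the bracket on
   smooth global sections; [bracket] is unconstrained on other sections. *)
Record lie_algebroid (R : realType) (m r : nat) (M : manifold R m)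
    (A : vector_bundle M r) := LieAlgebroid {
  anchor : forall x : M, A x -> (M -> R) -> R;
  bracket : section A -> section A -> section A;
  anchor_tangent : forall x (v : A x), tangent_vector x (anchor v);
  anchor_linear : forall x (a : R) (u v : A x) (f : M -> R), smooth f ->
    anchor (a *: u + v) f = a * anchor u f + anchor v f;
  anchor_smooth : forall (X : section A) (f : M -> R),
    smooth_section X -> smooth f -> smooth (fun x => anchor (X x) f);
  bracket_smooth : forall X Y, smooth_section X -> smooth_section Y ->
    smooth_section (bracket X Y);
  bracket_linear : forall (a : R) X Y Z,
    smooth_section X -> smooth_section Y -> smooth_section Z ->
    forall x, bracket (fun y => a *: X y + Y y) Z x =
              a *: bracket X Z x + bracket Y Z x;
  bracket_anti : forall X Y, smooth_section X -> smooth_section Y ->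
    forall x, bracket X Y x = - bracket Y X x;
  bracket_jacobi : forall X Y Z,
    smooth_section X -> smooth_section Y -> smooth_section Z ->
    forall x, bracket X (bracket Y Z) x + bracket Y (bracket Z X) x +
              bracket Z (bracket X Y) x = 0;
  bracket_leibniz : forall X Y (f : M -> R),
    smooth_section X -> smooth_section Y -> smooth f ->
    forall x, bracket X (fun y => f y *: Y y) x =
              f x *: bracket X Y x + anchor (X x) f *: Y x
}.

Section Calculus.
Variables (R : realType) (m r : nat) (M : manifold R m).
Variables (A : vector_bundle M r) (L : lie_algebroid A).

(* The right-hand side of
   (d_A w)(X_0, ..., X_k) = \sum_i (-1)^i rho(X_i)(w(..., X_i omitted, ...))
     + \sum_(i < j) (-1)^(i+j) w([X_i, X_j], ..., X_i, X_j omitted, ...),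
   where in the second sum [X_i, X_j] has been moved to the place of X_i, which
   changes the sign to (-1)^j. *)
Definition koszul (k : nat) (w : Aform A k) (X : 'I_k.+1 -> section A) (x : M)
    : R :=
  \sum_(i < k.+1) (-1) ^+ i *
    anchor L (X i x) (fun y => w y (fun a => X (lift i a) y)) +
  \sum_(i < k.+1) \sum_(j < k.+1 | (i < j)%N) (-1) ^+ j *
    w x (fun a => if lift j a == i then bracket L (X i) (X j) x
                  else X (lift j a) x).

(* The Lie algebroid differential.  There is exactly one such form when w is a
   smooth form, [koszul w] being alternating and linear over the smooth
   functions. *)
Definition dA (k : nat) (w : Aform A k) : Aform A k.+1 :=
  the_or (fun _ _ => 0) (fun eta : Aform A k.+1 =>
    is_form eta /\
    forall X : 'I_k.+1 -> section A, (forall i, smooth_section (X i)) ->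
      forall x, eta x (fun i => X i x) = koszul w X x).

(* D is a degree-zero derivation of the algebra of multisections, with
   D f = rho(X) f and D Y = [X, Y]. *)
Definition is_lie_derivative (X : section A)
    (D : forall k, multisection A k -> multisection A k) : Prop :=
  (forall k (P : multisection A k), is_multisection P ->
     is_multisection (D k P)) /\
  (forall k (c : R) (P Q : multisection A k),
     is_multisection P -> is_multisection Q -> forall x a,
     D k (fun y b => c * P y b + Q y b) x a = c * D k P x a + D k Q x a) /\
  (forall k l (P : multisection A k) (Q : multisection A l),
     is_multisection P -> is_multisection Q -> forall x a,
     D (k + l)%N (fun y => wedge (P y) (Q y)) x a =
     wedge (D k P x) (Q x) a + wedge (P x) (D l Q x) a) /\
  (forall f : M -> R, smooth f -> forall x a,
     D 0 (multi_of_fun A f) x a =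
     multi_of_fun A (fun y => anchor L (X y) f) x a) /\
  (forall Y : section A, smooth_section Y -> forall x a,
     D 1 (multi_of_section Y) x a = multi_of_section (bracket L X Y) x a).

(* L_X P = [X, P].  For X smooth, the values on smooth multisections are
   uniquely determined, because locally these are sums of wedge products of
   functions and sections. *)
Definition lie_derivative (X : section A) (k : nat) (P : multisection A k) :
    multisection A k :=
  the_or (fun _ _ _ _ => 0) (is_lie_derivative X) k P.

End Calculus.

Arguments dA {R m r M A} L {k} w x _.
Arguments lie_derivative {R m r M A} L X {k} P x _.

(* Main.v *)
(* At a point where Pi = X_0 ^ ... ^ X_k, and for the (k+1)-form eta = d_A alpha,
     Pi# zeta = \sum_j (-1)^(k+j) zeta(X_0, ..., X_j omitted, ..., X_k) X_j,
   so that Pi#(i_{Pi# beta} eta) = (-1)^k (i_eta Pi) Pi# beta; this also holds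
   where Pi = 0.  Hence the second condition says that the multivector
   T = L_{Pi# alpha} Pi - (-1)^(k+1) (i_eta Pi) Pi satisfies T# beta = 0 for
   every smooth form beta, and the first one that T = 0.  They are equivalent
   since T is alternating and, thanks to cutoff functions, the values at a point
   of the global smooth forms span the k-th exterior power of the dual. *)

Require Import Defs.
From HB Require Import structures.
From mathcomp Require Import all_boot all_order all_algebra all_fingroup.
From mathcomp Require Import all_classical all_reals all_analysis.
From mathcomp Require Import ring.
Import Order.TTheory GRing.Theory Num.Theory.
Import numFieldNormedType.Exports.
(* MathComp's [alternating] would otherwise shadow that of [Defs]. *)
Import Defs.

Set Implicit Arguments.
Unset Strict Implicit.
Unset Printing Implicit Defensive.

Local Open Scope classical_set_scope.
Local Open Scope ring_scope.

(** * Contraction of a decomposable multivector *)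

Section Algebra.
Variables (R : realType) (V : vectType R).
Let e := vbasis {:V}.

Lemma sum_coframe (v : V) : \sum_i coframe e i v *: tnth e i = v.
Proof.
rewrite [RHS](coord_vbasis (memvf v)); apply: eq_bigr => i _.
by rewrite /coframe lfunE /= -tnth_nth.
Qed.

(** In the Leibniz expansion of the determinant, the term of a permutation [s] sums over [i] to the
    basis expansion of [(-1) ^+ s * zeta (Y \o s)], which is [zeta Y]; there are k! permutations. *)
Lemma sum_decomposable_vec (k : nat) (zeta : ('I_k -> V) -> R) (Y : 'I_k -> V) :
  alternating zeta ->
  \sum_(i : {ffun 'I_k -> 'I_(\dim {:V})})
     zeta (fun a => tnth e (i a)) *
     decomposable_vec Y (fun a => coframe e (i a)) = k`!%:R * zeta Y.
Proof.
move=> zA; under eq_bigr => i _.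
  rewrite /decomposable_vec /determinant mulr_sumr.
  under eq_bigr do under eq_bigr do rewrite mxE.
  over.
rewrite exchange_big /= (eq_bigr (fun=> zeta Y)) => [|s _].
  by rewrite sumr_const card_Sn -[zeta Y *+ _]mulr_natl.
have -> : zeta Y = (-1) ^+ s * zeta (fun p => Y (s p)).
  by rewrite alternating_perm // mulrA -expr2 sqrr_sign mul1r.
have -> : (fun p => Y (s p)) =
    fun p => \sum_j coframe e j (Y (s p)) *: tnth e j.
  by apply/funext=> p; rewrite sum_coframe.
rewrite (alternating_expand (fun p j => coframe e j (Y (s p)))) // mulr_sumr.
by apply: eq_bigr => i _; rewrite mulrCA [zeta _ * _]mulrC.
Qed.

Lemma args_cat0 (T : Type) (k : nat) (a : 'I_k -> T) (b : 'I_0 -> T) :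
  args_cat a b = a.
Proof.
apply/funext=> p; rewrite /args_cat; case: fintype.splitP => [j|[]//] /= pj.
by congr a; apply: val_inj.
Qed.

Lemma full_contract_decomposable_vec (k : nat) (eta : ('I_k -> V) -> R)
    (X : 'I_k -> V) :
  alternating eta -> full_contract eta (decomposable_vec X) = eta X.
Proof.
move=> eA; rewrite /full_contract /contract -/e.
under eq_bigr => i _.
  rewrite args_cat0.
  over.
by rewrite sum_decomposable_vec // mulKf // pnatr_eq0 -lt0n fact_gt0.
Qed.

Lemma args_catS_max (T : Type) (k : nat) (a : 'I_k -> T) (b : 'I_1 -> T) :
  args_cat a b ord_max = b ord0.
Proof.
rewrite /args_cat; case: fintype.splitP => [j /= jE|j _]; last by rewrite ord1.
by have := ltn_ord j; rewrite -jE ltnn.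
Qed.

Lemma args_catS_lift (T : Type) (k : nat) (a : 'I_k -> T) (b : 'I_1 -> T) p :
  args_cat a b (lift ord_max p) = a p.
Proof.
rewrite /args_cat; case: fintype.splitP => j /=.
  by rewrite /bump leqNgt ltn_ord /= => jE; congr a; apply: val_inj.
rewrite /bump leqNgt ltn_ord /= => pE; have := ltn_ord p.
by rewrite [X in (X < _)%N]pE ltnNge leq_addr.
Qed.

(** Laplace expansion of the determinant along its last row, that of the covector in [b]. *)
Lemma decomposable_vec_catr (k : nat) (X : 'I_k.+1 -> V) (a : 'I_k -> dual V)
    (b : 'I_1 -> dual V) :
  decomposable_vec X (args_cat a b) =
  \sum_(j < k.+1) ((-1) ^+ (k + j) * decomposable_vec (fun p => X (lift j p)) a) *
         b ord0 (X j).
Proof.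
rewrite /decomposable_vec (expand_det_row _ ord_max); apply: eq_bigr => j _.
rewrite mxE args_catS_max mulrC /cofactor /=; congr (_ * \det _ * _).
by apply/matrixP=> p q; rewrite !mxE args_catS_lift.
Qed.

(** After Laplace expansion, summing each minor against [zeta] gives k! times the value of [zeta],
    which cancels the normalization of [contract]. *)
Lemma vec_of_contract_decomposable_vec (k : nat) (zeta : ('I_k -> V) -> R)
    (X : 'I_k.+1 -> V) :
  alternating zeta ->
  vec_of (contract (l := 1) zeta (decomposable_vec X)) =
  \sum_(j < k.+1) ((-1) ^+ (k + j) * zeta (fun p => X (lift j p))) *: X j.
Proof.
move=> zA.
have cE b : contract (l := 1) zeta (decomposable_vec X) b =
    \sum_(j < k.+1) ((-1) ^+ (k + j) * zeta (fun p => X (lift j p))) * b ord0 (X j).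
  rewrite /contract -/e; under eq_bigr do rewrite decomposable_vec_catr mulr_sumr.
  rewrite exchange_big /= mulr_sumr; apply: eq_bigr => j _.
  have kN0 : k`!%:R != 0 :> R by rewrite pnatr_eq0 -lt0n fact_gt0.
  rewrite -[zeta (fun p => X _)](mulKf kN0) -sum_decomposable_vec //.
  rewrite mulrCA -[in RHS]mulrA; congr (_ * _).
  rewrite mulr_sumr mulr_suml; apply: eq_bigr => i _.
  by rewrite !mulrA; congr (_ * _ * _); exact: mulrC.
rewrite /vec_of -/e; under eq_bigr do rewrite cE scaler_suml.
rewrite exchange_big /=; apply: eq_bigr => j _.
rewrite -[in RHS](sum_coframe (X j)) scaler_sumr.
by apply: eq_bigr => i _; rewrite scalerA.
Qed.

Lemma alternating_cons_sum (k : nat) (w : ('I_k.+1 -> V) -> R)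
    (I : finType) (c : I -> R) (u : I -> V) (b : 'I_k -> V) :
  alternating w ->
  w (args_cons (\sum_j c j *: u j) b) = \sum_j c j * w (args_cons (u j) b).
Proof.
have consE v : args_cons v b = update (args_cons 0 b) ord0 v.
  apply/funext=> p; rewrite /args_cons /update.
  by case: unliftP => [q|] ->.
move=> wA; rewrite consE (alternating_update_sum _ _ _ _ _ wA).
by apply: eq_bigr => j _; rewrite consE.
Qed.

(** For distinct indices [X i] occurs twice among the arguments. Otherwise [X j] has been moved to
    the front past j arguments, by a cycle of sign (-1)^j. *)
Lemma alternating_cons_lift (k : nat) (w : ('I_k.+1 -> V) -> R)
    (X : 'I_k.+1 -> V) (i j : 'I_k.+1) :
  alternating w ->
  w (args_cons (X i) (fun p => X (lift j p))) =
  if i == j then (-1) ^+ j * w X else 0.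
Proof.
move=> wA; case: eqVneq => [->|ne].
  rewrite (_ : args_cons _ _ = fun p => X (lift_perm ord0 j 1 p)).
    by rewrite alternating_perm // odd_lift_perm odd_perm1 /= addbF signr_odd.
  apply/funext=> p; rewrite /args_cons.
  by case: unliftP => [q|] ->; rewrite ?lift_perm_lift ?lift_perm_id ?perm1.
have ji : j != i by rewrite eq_sym.
have [q iE _] := unlift_some ji.
by apply: (wA.2 _ ord0 (lift ord0 q)); rewrite // /args_cons unlift_none liftK -iE.
Qed.

(* The coefficient of [X j] on the left is
   (-1)^(k+j) \sum_i c_i eta(X_i, X_0, ..., X_j omitted, ..., X_k), where only
   i = j contributes. *)
Lemma vec_of_contract_insert (k : nat) (eta : ('I_k.+1 -> V) -> R)
    (X : 'I_k.+1 -> V) (c : 'I_k.+1 -> R) :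
  alternating eta ->
  vec_of (contract (l := 1) (insert (\sum_j c j *: X j) eta)
            (decomposable_vec X)) =
  ((-1) ^+ k * eta X) *: \sum_j c j *: X j.
Proof.
move=> eA; rewrite vec_of_contract_decomposable_vec; last exact: alternating_cons.
rewrite scaler_sumr; apply: eq_bigr => j _; rewrite scalerA; congr (_ *: _).
rewrite /insert alternating_cons_sum //.
rewrite (bigD1 j) //= big1 => [|i ij].
  rewrite alternating_cons_lift // eqxx addr0 exprD -!mulrA; congr (_ * _).
  rewrite mulrCA [X in c j * X]mulrA -expr2 sqrr_sign mul1r; exact: mulrC.
by rewrite alternating_cons_lift // (negbTE ij) mulr0.
Qed.

Lemma vec_of_contract_linear (k : nat) (zeta : ('I_k -> V) -> R) (c : R)
    (P Q : ('I_k.+1 -> dual V) -> R) :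
  vec_of (contract (l := 1) zeta (fun a => c * P a + Q a)) =
  c *: vec_of (contract (l := 1) zeta P) + vec_of (contract (l := 1) zeta Q).
Proof.
rewrite /vec_of scaler_sumr -big_split; apply: eq_bigr => i _ /=.
rewrite scalerA -scalerDl; congr (_ *: _).
rewrite /contract mulrCA -mulrDr [c * _]mulr_sumr -big_split; congr (_ * _).
by apply: eq_bigr => j _ /=; rewrite mulrDr mulrCA.
Qed.

Lemma vec_of_contract0 (k : nat) (zeta : ('I_k -> V) -> R)
    (P : ('I_k.+1 -> dual V) -> R) :
  (forall a, P a = 0) -> vec_of (contract (l := 1) zeta P) = 0.
Proof.
move=> P0; rewrite /vec_of big1 // => i _.
by rewrite /contract big1 ?mulr0 ?scale0r // => j _; rewrite P0 mulr0.
Qed.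

Lemma vec_of_contractZl (k : nat) (zeta : ('I_k -> V) -> R) (c : R)
    (P : ('I_k.+1 -> dual V) -> R) :
  vec_of (contract (l := 1) (fun v => c * zeta v) P) =
  c *: vec_of (contract (l := 1) zeta P).
Proof.
rewrite /vec_of scaler_sumr; apply: eq_bigr => i _.
rewrite scalerA /contract mulrCA [c * _]mulr_sumr; congr (_ * _ *: _).
by apply: eq_bigr => j _; rewrite mulrA.
Qed.

(** When [P] is the wedge of the [X j], the inner contraction is a linear combination of the [X j],
    so [vec_of_contract_insert] applies to it. *)
Lemma sharp_insert_sharp (k : nat) (P : ('I_k.+1 -> dual V) -> R)
    (eta : ('I_k.+1 -> V) -> R) (zeta : ('I_k -> V) -> R) :
  (forall a, P a = 0) \/ (exists X, P = decomposable_vec X) ->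
  alternating eta -> alternating zeta ->
  vec_of (contract (l := 1)
            (insert (vec_of (contract (l := 1) zeta P)) eta) P) =
  ((-1) ^+ k * full_contract eta P) *: vec_of (contract (l := 1) zeta P).
Proof.
move=> [P0 _ _|[X ->] eA zA]; first by rewrite !vec_of_contract0 // scaler0.
by rewrite [vec_of (contract zeta _)]vec_of_contract_decomposable_vec //
  vec_of_contract_insert //
  full_contract_decomposable_vec.
Qed.

(** * Multivectors determined by their contractions *)

Lemma coframe_basis_expand (r : nat) (u : r.-tuple V) (b : dual V) :
  basis_of fullv u -> b = \sum_i b (tnth u i) *: coframe u i.
Proof.
move=> uB; apply/lfunP=> v.
rewrite sum_lfunE {1}(coord_basis uB (memvf v)) linear_sum.
apply: eq_bigr => i _; rewrite linearZ scale_lfunE lfunE /= -tnth_nth.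
exact: mulrC.
Qed.

Lemma alternating_catr1 (W : vectType R) (k : nat) (P : ('I_k.+1 -> W) -> R)
    (a : 'I_k -> W) :
  alternating P -> alternating (fun b : 'I_1 -> W => P (args_cat a b)).
Proof.
have catU (b : 'I_1 -> W) i u :
    args_cat a (update b i u) = update (args_cat a b) ord_max u.
  apply/funext=> p; rewrite [RHS]/update.
  case: (unliftP ord_max p) => [q|] ->.
    by rewrite !args_catS_lift eq_sym (negbTE (neq_lift _ _)).
  by rewrite args_catS_max /update [i]ord1 !eqxx.
move=> [Pl _]; split=> [b i c u v|b i j]; first by rewrite !catU Pl.
by rewrite !ord1 eqxx.
Qed.

(** By multilinearity it suffices to evaluate [P] on covectors of the dual basis. Such a value is
    the last covector applied to the contraction of [P] by the wedge of the first k. *)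
Lemma alternating_eq0 (k r : nat) (u : r.-tuple V)
    (P : ('I_k.+1 -> dual V) -> R) :
  basis_of fullv u -> alternating P ->
  (forall i : 'I_k -> 'I_r, vec_of (contract (l := 1)
     (decomposable_form (fun p => coframe u (i p))) P) = 0) ->
  forall a, P a = 0.
Proof.
move=> uB PA H a.
have -> : a = fun p => \sum_i a p (tnth u i) *: coframe u i.
  by apply/funext=> p; exact: coframe_basis_expand.
rewrite (alternating_expand (fun p i => a p (tnth u i))) // big1 // => f _.
pose b := coframe u (f ord_max); pose i (p : 'I_k) := f (lift ord_max p).
have /(congr1 b) := H i; rewrite linear0 vec_ofE; last first.
  rewrite (_ : contract _ _ = fun b : 'I_1 -> dual V =>
      P (args_cat (fun p => coframe u (i p)) b)).
    exact: alternating_catr1.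
  by apply/funext=> c; exact: (contract_decomposable (l := 1)).
rewrite (contract_decomposable (l := 1)) // => E.
rewrite (_ : (fun p => _) =
  args_cat (fun p => coframe u (i p)) (fun _ : 'I_1 => b)) ?E ?mulr0 //.
apply/funext=> p; case: (unliftP ord_max p) => [q|] ->.
  by rewrite args_catS_lift.
by rewrite args_catS_max.
Qed.

End Algebra.

(** * A smooth cutoff function *)

Section Cutoff.
Variable R : realType.
Implicit Types (p : {poly R}) (t : R).

(* Closing exp(-1/t) under differentiation produces the factor [p.[t^-1]]. *)
Definition flat p t : R := if 0 < t then p.[t^-1] * expR (- t^-1) else 0.

Lemma horner_le_exp p : exists2 C : R, 0 <= C &
  forall s, 1 <= s -> `|p.[s]| <= C * s ^+ size p.
Proof.
exists (\sum_(i < size p) `|p`_i|); first by apply: sumr_ge0.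
move=> s s1; rewrite horner_coef mulr_suml.
apply: le_trans (ler_norm_sum _ _ _) _; apply: ler_sum => i _.
rewrite normrM ler_wpM2l // normrX ger0_norm ?(le_trans ler01) //.
by rewrite ler_weXn2l // ltnW.
Qed.

(** The quadratic bound forces the derivative at 0 to vanish. With s = 1/t and n the size of [p], it
    follows from exp(s) >= s^(n+2)/(n+2)!. *)
Lemma flat_le_sqr p : exists2 C : R, 0 <= C &
  forall t, t <= 1 -> `|flat p t| <= C * t ^+ 2.
Proof.
have [C C0 pC] := horner_le_exp p; set n := size p in pC.
exists (C * n.+2`!%:R) => [|t t1]; first by rewrite mulr_ge0.
rewrite /flat; case: ltP => [t0|_]; last first.
  by rewrite normr0 mulr_ge0 ?sqr_ge0 // mulr_ge0.
have s1 : 1 <= t^-1 by rewrite invf_ge1.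
have s0 : 0 < t^-1 by rewrite invr_gt0.
rewrite normrM (ger0_norm (expR_ge0 _)).
apply: (@le_trans _ _ (C * t^-1 ^+ n * (n.+2`!%:R * t ^+ n.+2))); last first.
  rewrite -!mulrA ler_wpM2l // mulrCA ler_wpM2l //.
  by rewrite exprVn -addn2 exprD mulKf // expf_neq0 // gt_eqF.
apply: ler_pM => //; first exact: pC.
rewrite expRN -[leRHS]invrK lef_pV2 ?posrE ?expR_gt0 //; last first.
  by rewrite invr_gt0 mulr_gt0 ?exprn_gt0 // ltr0n fact_gt0.
apply: le_trans (expR_ge1Dxn n.+1 (ltW s0)).
by rewrite invfM mulrC -exprVn ler_wpDl.
Qed.

Lemma is_derive_horner p t : is_derive t 1 (horner p) p^`().[t].
Proof.
by apply: DeriveDef; [exact: derivable_horner|rewrite derivE derive1E].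
Qed.

(** The family [flat] is thus closed under differentiation, so its members are smooth. For t > 0
    this is the chain rule; for t < 0 the function is locally zero. *)
Lemma is_derive_flat p t : is_derive t 1 (flat p) (flat ('X^2 * (p - p^`())) t).
Proof.
have [t0|t0|->] := ltgtP t 0.
- rewrite {2}/flat ltNge (ltW t0) /=.
  apply: (near_eq_is_derive (f := cst 0)).
    by near=> s; rewrite /flat ltNge (ltW (_ : s < 0)) //; near: s; exact: lt_nbhsl.
- rewrite {2}/flat t0.
  apply: (near_eq_is_derive (f := fun t => p.[t^-1] * expR (- t^-1))).
    near=> s; rewrite /flat (_ : 0 < s) //.
    by near: s; exact: lt_nbhsr.
  have tN0 : t != 0 by rewrite gt_eqF.
  have dV : is_derive t 1 (fun y : R => y^-1) (- t ^- 2).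
    by have := is_deriveV (f := id) tN0 (is_derive_id t 1); rewrite [_%:A]mulr1.
  have dp : is_derive t 1 (fun y : R => p.[y^-1]) (p^`().[t^-1] * - t ^- 2).
    exact: is_derive1_comp (is_derive_horner p _) dV.
  have de : is_derive t 1 (fun y : R => expR (- y^-1)) (expR (- t^-1) * - - t ^- 2).
    exact: is_derive1_comp (is_derive_expR _) (is_deriveN dV).
  have := is_deriveM dp de.
  congr is_derive.
  rewrite -![_ *: _]/(_ * _) hornerM hornerXn hornerD hornerN opprK exprVn.
  by ring.
rewrite {2}/flat ltxx.
have flat0 : flat p 0 = 0 by rewrite /flat ltxx.
(* At 0 the difference quotient is bounded by C|h|. *)
suff dq : (fun h : R => h^-1 *: ((flat p \o shift 0) (h *: 1) - flat p 0)) @ 0^'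
    --> (0 : R).
  by apply: DeriveDef; [apply/cvg_ex; exists 0|exact/cvg_lim].
apply/cvgrPdist_le => eps e0; have [C C0 pC] := flat_le_sqr p.
near=> h.
have h0 : h != 0 by near: h; exact: nbhs_dnbhs_neq.
(* The bound 1 keeps [h] in the range of the quadratic estimate; [C + 1] is positive even if [C] is
   zero. *)
have hC : `|h| <= Num.min 1 (eps / (C + 1)).
  near: h; apply: dnbhs0_le.
  by rewrite lt_min ltr01 divr_gt0 // ltr_wpDl.
rewrite /= flat0 addr0 subr0 sub0r normrN [h%:A]mulr1.
rewrite -[_ *: _]/(_ * _) normrM normfV ler_pdivrMl ?normr_gt0 //.
move: hC; rewrite le_min => /andP[h1 hC].
apply: le_trans (pC _ (le_trans (ler_norm _) h1)) _.
rewrite -[h ^+ 2](ger0_norm (sqr_ge0 h)) normrX expr2 mulrCA ler_wpM2l //.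
rewrite ler_pdivlMr ?ltr_wpDl // in hC; apply: le_trans hC.
by rewrite mulrC ler_wpM2l // lerDl.
Unshelve. all: by end_near.
Qed.

End Cutoff.

(** * Functions of class C^k on open sets *)

Section Ck.
Variables (R : realType) (m : nat).
Implicit Types (U V : set 'rV[R]_m) (f g : 'rV[R]_m -> R).

(** Restricting to the line through [y] directed by [v] reduces this to the chain rule in one
    variable. *)
Lemma is_derive_comp1 (h : R -> R) f y v (dh df : R) :
  is_derive (f y) 1 h dh -> is_derive y v f df ->
  is_derive y v (h \o f) (dh * df).
Proof.
move=> hD fD; pose g (t : R) := f (t *: v + y).
have lineE (F : 'rV[R]_m -> R) : 'D_v F y = 'D_1 (fun t : R => F (t *: v + y)) 0.
  rewrite /derive; set g1 := fun h => h^-1 *: _; set g2 := fun h => h^-1 *: _.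
  suff -> : g1 = g2 by []; apply/funext=> t; rewrite /g1 /g2 /=.
  by rewrite addr0 scale0r add0r [t%:A]mulr1.
have g0 : g 0 = f y by rewrite /g scale0r add0r.
have gD : is_derive (0 : R) 1 g df.
  apply: DeriveDef; last by rewrite -lineE; have [] := fD.
  by apply: (derivable1P f y v).1; have [] := fD.
rewrite -g0 in hD; have [hgd hgD] := is_derive1_comp hD gD.
by apply: DeriveDef; [exact: (derivable1P (h \o f) y v).2 hgd|rewrite lineE].
Qed.

(** Continuity and partial derivatives at a point depend only on the germ there. As [V] is open, the
    partial derivatives of [f] and [g] again agree on [V], which feeds the induction. *)
Lemma Ck_near k U f :
  (forall y, U y -> exists V g,
     [/\ open V, V y, (forall z, V z -> f z = g z) & Ck k V g]) -> Ck k U f.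
Proof.
have nearV V y g h : open V -> V y -> (forall z, V z -> g z = h z) ->
    \forall z \near y, g z = h z.
  by move=> oV Vy gh; near=> z; apply: gh; near: z; exact: open_nbhs_nbhs.
have base V h g y : open V -> V y -> (forall z, V z -> h z = g z) ->
    {for y, continuous g} -> {for y, continuous h}.
  move=> oV Vy fg gc; rewrite /prop_for /continuous_at fg //.
  apply: cvg_trans gc; apply: (@near_eq_cvg _ _ (nbhs y) _ g h).
  by apply: (nearV V) => // z Vz; rewrite fg.
elim: k U f => [|k IH] U f H.
  split=> // y Uy; have [V [g [oV Vy fg [gc _]]]] := H y Uy.
  exact: base oV Vy fg (gc y Vy).
split=> [y Uy|i].
  by have [V [g [oV Vy fg [gc _]]]] := H y Uy; exact: base oV Vy fg (gc y Vy).
split=> [y Uy|].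
  have [V [g [oV Vy fg [_ /(_ i) [gd _]]]]] := H y Uy.
  apply: (near_eq_derivable (f := g)); last exact: gd.
  by apply: (nearV V) => // z Vz; rewrite fg.
apply: IH => y Uy.
have [V [g [oV Vy fg [_ /(_ i) [_ gD]]]]] := H y Uy.
exists V, ('D_(delta_mx 0 i) g); split=> // z Vz.
by apply: near_eq_derive; exact: nearV oV Vz fg.
Unshelve. all: by end_near. Qed.

Lemma Ck_sub k U V f : U `<=` V -> Ck k V f -> Ck k U f.
Proof.
move=> UV; elim: k f => [|k IH] f [fc fd]; first by split=> // y /UV; exact: fc.
split=> // [y /UV|i]; first exact: fc.
by have [fdi fDi] := fd i; split=> [y /UV|]; [exact: fdi|exact: IH].
Qed.

Lemma CkW k U f : Ck k.+1 U f -> Ck k U f.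
Proof.
elim: k f => [|k IH] f [fc fd]; split=> // i.
by have [fdi fDi] := fd i; split=> //; exact: IH.
Qed.

Lemma Ck_eq k U f g : open U -> (forall z, U z -> f z = g z) -> Ck k U g ->
  Ck k U f.
Proof. by move=> oU fg gU; apply: Ck_near => y Uy; exists U, g. Qed.

Lemma Ck_cst k U (c : R) : Ck k U (fun=> c).
Proof.
elim: k c => [|k IH] c; first by split=> // y _; exact: cst_continuous.
split=> [y _|i]; first exact: cst_continuous.
split=> [y _|]; first exact: derivable_cst.
rewrite (_ : 'D__ _ = fun=> 0); first exact: IH.
by apply/funext=> y; exact: derive_cst.
Qed.

Lemma CkD k U f g : open U -> Ck k U f -> Ck k U g ->
  Ck k U (fun y => f y + g y).
Proof.
move=> oU; elim: k f g => [|k IH] f g [fc fd] [gc gd].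
  by split=> // y Uy; apply: continuousD; [exact: fc|exact: gc].
split=> [y Uy|i]; first by apply: continuousD; [exact: fc|exact: gc].
have [fdi fDi] := fd i; have [gdi gDi] := gd i.
split=> [y Uy|]; first by apply: derivableD; [exact: fdi|exact: gdi].
apply: Ck_eq (IH _ _ fDi gDi) => // y Uy.
by apply: deriveD; [exact: fdi|exact: gdi].
Qed.

Lemma CkM k U f g : open U -> Ck k U f -> Ck k U g ->
  Ck k U (fun y => f y * g y).
Proof.
move=> oU; elim: k f g => [|k IH] f g fU gU.
  by split=> // y Uy; apply: continuousM; [exact: fU.1|exact: gU.1].
split=> [y Uy|i]; first by apply: continuousM; [exact: fU.1|exact: gU.1].
have [fdi fDi] := fU.2 i; have [gdi gDi] := gU.2 i.
split=> [y Uy|]; first by apply: derivableM; [exact: fdi|exact: gdi].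
apply: (Ck_eq (g := fun y => f y * 'D_(delta_mx 0 i) g y +
                             g y * 'D_(delta_mx 0 i) f y)) => // [y Uy|].
  by apply: deriveM; [exact: fdi|exact: gdi].
by apply: CkD => //; apply: IH => //; exact: CkW.
Qed.

(** The sequence [h] lists the successive derivatives of the outer function; differentiating once
    shifts the index, so the induction on [k] treats all [n] together. *)
Lemma Ck_comp k U (h : nat -> R -> R) f :
  (forall n (t : R), is_derive t (1 : R) (h n) (h n.+1 t)) ->
  open U -> Ck k U f -> forall n, Ck k U (fun y => h n (f y)).
Proof.
move=> hD oU.
have hc n y : Ck 0 U f -> U y -> {for y, continuous (fun y => h n (f y))}.
  move=> fU Uy; apply: continuous_comp; first exact: fU.1.
  by apply/differentiable_continuous/derivable1_diffP; have [] := hD n (f y).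
have c0 j : Ck j U f -> Ck 0 U f by case: j => [|j] [].
elim: k => [|k IH] fU n.
  by split=> // y Uy; exact: hc.
split=> [y Uy|i]; first by apply: hc => //; exact: (c0 k.+1).
have hDy y : U y -> is_derive y (delta_mx 0 i) (fun y => h n (f y))
    (h n.+1 (f y) * 'D_(delta_mx 0 i) f y).
  move=> Uy; apply: (is_derive_comp1 (hD n (f y))).
  by apply: DeriveDef => //; exact: (fU.2 i).1.
split=> [y Uy|]; first by have [] := hDy y Uy.
apply: (Ck_eq (g := fun y => h n.+1 (f y) * 'D_(delta_mx 0 i) f y)) => // [y Uy|].
  by have [] := hDy y Uy.
apply: CkM => //; last exact: (fU.2 i).2.
by apply: IH; exact: CkW.
Qed.

Lemma Ck_sum k U (I : Type) (s : seq I) (F : I -> 'rV[R]_m -> R) :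
  open U -> (forall i, Ck k U (F i)) -> Ck k U (fun y => \sum_(i <- s) F i y).
Proof.
move=> oU FU; elim: s => [|i s IH].
  by under eq_fun do rewrite big_nil; exact: Ck_cst.
by under eq_fun do rewrite big_cons; exact: CkD.
Qed.

Lemma Ck_prod k U (I : Type) (s : seq I) (F : I -> 'rV[R]_m -> R) :
  open U -> (forall i, Ck k U (F i)) -> Ck k U (fun y => \prod_(i <- s) F i y).
Proof.
move=> oU FU; elim: s => [|i s IH].
  by under eq_fun do rewrite big_nil; exact: Ck_cst.
by under eq_fun do rewrite big_cons; exact: CkM.
Qed.

Lemma Ck_det k U (n : nat) (F : 'rV[R]_m -> 'M[R]_n) :
  open U -> (forall i j, Ck k U (fun y => F y i j)) ->
  Ck k U (fun y => \det (F y)).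
Proof.
move=> oU FU; apply: Ck_sum => // s; apply: CkM => //; first exact: Ck_cst.
by apply: Ck_prod.
Qed.

End Ck.

(** * Smooth functions and forms with prescribed support *)

Section Manifold.
Variables (R : realType) (m : nat) (M : manifold R m).
Implicit Types (V W : set M) (f g : M -> R).

Lemma open_chart (c : chart R m M) W :
  open W -> open [set y | chart_cod c y /\ W (chart_inv c y)].
Proof.
move=> oW; rewrite openE => y [cy Wy]; apply: filterI.
  by apply: open_nbhs_nbhs; split=> //; exact: chart_cod_open.
by apply: (chart_inv_cont cy); apply: open_nbhs_nbhs.
Qed.

Lemma smooth_on_near W f :
  (forall y, W y -> exists V g,
     [/\ open V, V y, (forall z, V z -> f z = g z) & smooth_on V g]) ->
  smooth_on W f.
Proof.
move=> H c ac k; apply: Ck_near => y [cy Wy].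
have [V [g [oV Vy fg gV]]] := H _ Wy.
exists [set y | chart_cod c y /\ V (chart_inv c y)], (fun y => g (chart_inv c y)).
by split=> //; [exact: open_chart|move=> z [_ /fg]|exact: gV].
Qed.

Lemma smooth_on_sub V W f : V `<=` W -> smooth_on W f -> smooth_on V f.
Proof.
move=> VW fW c ac k; apply: Ck_sub (fW c ac k) => y [cy /VW Wy].
by split.
Qed.

Lemma smooth_on_cst W (a : R) : smooth_on W (fun=> a : R).
Proof. by move=> c ac k; exact: Ck_cst. Qed.

Lemma smooth_onM W f g : open W -> smooth_on W f -> smooth_on W g ->
  smooth_on W (fun y => f y * g y).
Proof.
move=> oW fW gW c ac k; apply: CkM; [exact: open_chart|exact: fW|exact: gW].
Qed.

Lemma smooth_on_det W (n : nat) (F : M -> 'M[R]_n) :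
  open W -> (forall i j, smooth_on W (fun y => F y i j)) ->
  smooth_on W (fun y => \det (F y)).
Proof.
move=> oW FW c ac k; apply: (Ck_det (F := fun y => F (chart_inv c y))).
  exact: open_chart.
by move=> i j; exact: FW.
Qed.

(** A bump exp(-1/q) is built in a chart and extended by zero. Its support lies in the image [K] of
    a compact cube, which is closed because M is Hausdorff. *)
Lemma smooth_cutoff W x : open W -> W x ->
  exists f K, [/\ smooth f, f x != 0, closed K, K `<=` W &
                  forall y, ~ K y -> f y = 0].
Proof.
move=> oW Wx; have [d ad dx] := atlas_cover x.
pose p := chart_map d x; pose O := [set y | chart_cod d y /\ W (chart_inv d y)].
have Op : O p by split; [exact: chart_map_cod|rewrite chart_mapK].
have [e e0 eO] : exists2 e : R, 0 < e & ball p e `<=` O.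
  by apply/nbhs_ballP; apply: open_nbhs_nbhs; split=> //; exact: open_chart.
(* Halving the radius puts the closed cube inside the open ball. *)
pose I i := `[p 0 i - e / 2, p 0 i + e / 2]%classic.
pose B := [set v : 'rV[R]_m | forall i, I i (v 0 i)].
have BO : B `<=` O.
  move=> v Bv; apply: eO; split=> // i j; rewrite ord1 /ball /=.
  have := Bv j; rewrite /I /= in_itv /= -ler_distlC. move=>/le_lt_trans; apply.
  by rewrite ltr_pdivrMr // mulr_natr mulr2n ltrDl.
pose K := chart_inv d @` B.
have KW : K `<=` W by move=> _ [v /BO[_ ?] <-].
have Kd : K `<=` chart_dom d.
  by move=> _ [v /BO[? _] <-]; exact: chart_inv_dom.
have clK : closed K.
  apply: compact_closed; first exact: manifold_hausdorff.
  apply: continuous_compact; last first.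
    by apply: (rV_compact (A := I)) => i; exact: segment_compact.
  rewrite continuous_subspace_in => v; rewrite inE => Bv.
  apply: continuous_subspaceT_for => //.
  by apply: chart_inv_cont; exact: (BO v Bv).1.
(* [h 0] is exp(-1/t) extended by zero, and [h n] its n-th derivative. *)
pose h n := flat (iter n (fun q : {poly R} => 'X^2 * (q - q^`())) 1).
have hD n (t : R) : is_derive t (1 : R) (h n) (h n.+1 t) by exact: is_derive_flat.
(* (e/2)^2 minus the squared Euclidean distance to [p]: where it is positive, every coordinate is
   within e/2 of that of [p]. *)
pose q (v : 'rV[R]_m) :=
  (e / 2) ^+ 2 + \sum_i (- 1) * ((v 0 i - p 0 i) * (v 0 i - p 0 i)).
pose f y := if asbool (chart_dom d y) then h 0%N (q (chart_map d y)) else 0.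
have fK y : ~ K y -> f y = 0.
  rewrite /f; case: asboolP => // dy nK; rewrite /h /flat; case: ltP => // q0.
  exfalso; apply: nK; exists (chart_map d y); last by rewrite chart_mapK.
  move=> i; rewrite /I /= in_itv /= -ler_distlC -ler_sqr ?nnegrE ?divr_ge0 ?(ltW e0) //.
  rewrite real_normK ?num_real // ltW // -subr_gt0; apply: lt_le_trans q0 _.
  rewrite /q lerD2l (bigD1 i) //= -sqrrN opprB expr2 mulN1r gerDl.
  by apply: sumr_le0 => j _; rewrite mulN1r oppr_le0 -expr2 sqr_ge0.
exists f, K; split=> //.
- apply: smooth_on_near => y _; have [dy|dy] := pselect (chart_dom d y).
    exists (chart_dom d), (fun y => h 0%N (q (chart_map d y))); split=> //.
    + exact: chart_dom_open.
    + by move=> z dz; rewrite /f asboolT.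
    move=> c ac k.
    have oc : open [set y | chart_cod c y /\ chart_dom d (chart_inv c y)].
      by apply: open_chart; exact: chart_dom_open.
    apply: (Ck_comp (h := h) hD) => //; apply: CkD => //; first exact: Ck_cst.
    apply: Ck_sum => // i; apply: CkM => //; first exact: Ck_cst.
    by apply: CkM => //; apply: CkD => //; by [exact: atlas_compat|exact: Ck_cst].
  (* A point outside the chart domain has the open complement of [K] as a neighbourhood, where the
     bump vanishes. *)
  exists (~` K), (fun=> 0); split=> //; first exact: closed_openC.
  + by move=> /Kd.
  + exact: smooth_on_cst.
rewrite /f asboolT // /h /flat /q big1 ?addr0 => [|i _].
  by rewrite exprn_gt0 ?divr_gt0 // hornerE mul1r gt_eqF ?expR_gt0.
by rewrite -/p subrr !mulr0.
Qed.

End Manifold.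

(** * Constructions of alternating maps *)

Section Alternating.
Variables (R : realType) (V : vectType R) (k : nat).

Lemma alternating_linear (c : R) (P Q : ('I_k -> V) -> R) :
  alternating P -> alternating Q -> alternating (fun a => c * P a + Q a).
Proof.
move=> [Pl Pa] [Ql Qa]; split=> [b i a u v|b i j ne bij].
  by rewrite Pl Ql; ring.
by rewrite (Pa _ i j) // (Qa _ i j) // mulr0 addr0.
Qed.

Lemma alternating0 : alternating (fun _ : 'I_k -> V => 0 : R).
Proof. by split=> // *; rewrite mulr0 addr0. Qed.

Lemma alternating_decomposable_form (a : 'I_k -> dual V) :
  alternating (decomposable_form a).
Proof.
rewrite /decomposable_form; split=> [b i c u v|b i j ne bij].
  (* The vectors index columns; transposing makes them rows. *)
  rewrite -det_tr -[X in _ = _ * X + _]det_tr -[X in _ = _ + X]det_tr.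
  rewrite -[X in _ = _ + X]mul1r; apply: (determinant_multilinear (i0 := i)).
  - by apply/rowP=> p; rewrite !mxE /update eqxx linearP mul1r.
  - by apply/matrixP=> p q; rewrite !mxE /update eq_sym (negbTE (neq_lift _ _)).
  - by apply/matrixP=> p q; rewrite !mxE /update eq_sym (negbTE (neq_lift _ _)).
rewrite -det_tr; apply: (determinant_alternate ne) => p.
by rewrite !mxE bij.
Qed.

End Alternating.

(** * Global forms with prescribed direction at a point, and alternation of the operators *)

Section Sections.
Variables (R : realType) (m r : nat) (M : manifold R m) (A : vector_bundle M r).

(** The local wedge of coframe elements is multiplied by a cutoff supported in the frame domain and
    extended by zero. In another frame its coefficients are the cutoff times determinants built from
    transition functions. *)
Lemma form_through_coframe (k : nat) (e : local_frame r A) (x : M)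
    (i : 'I_k -> 'I_r) :
  frames e -> frame_dom e x ->
  exists (beta : Aform A k) (c : R), [/\ is_form beta, c != 0 &
    beta x = fun X => c * decomposable_form (fun p => coframe (e x) (i p)) X].
Proof.
move=> fe ex; have [f [K [fS fx cK Ke fK]]] := smooth_cutoff (frame_open fe) ex.
exists (fun y X => f y * decomposable_form (fun p => coframe (e y) (i p)) X), (f x).
split=> //; split=> [y|e' fe' j].
  have := alternating_linear (f y) (alternating_decomposable_form
    (fun p => coframe (e y) (i p))) (@alternating0 _ _ _).
  by congr alternating; apply/funext=> X; rewrite addr0.
apply: smooth_on_near => y e'y; have [ey|ey] := pselect (frame_dom e y).
  have oe : open (frame_dom e `&` frame_dom e').
    by apply: openI; exact: frame_open.
  exists (frame_dom e `&` frame_dom e'), (fun y => f y *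
    \det (\matrix_(p, q) coord (e y) (i p) (tnth (e' y) (j q)))); split=> //.
    move=> z _; congr (_ * \det _); apply/matrixP=> p q.
    by rewrite !mxE /coframe lfunE.
  apply: smooth_onM => //; first exact: smooth_on_sub fS.
  apply: smooth_on_det => // p q; under eq_fun do rewrite mxE.
  exact: frame_compat.
exists (~` K), (fun=> 0); split=> //; first exact: closed_openC.
- by move=> /Ke.
- by move=> z nK; rewrite fK // mul0r.
- exact: smooth_on_cst.
Qed.

(* The junk values of [dA] and [lie_derivative] are alternating as well, so that
   neither the existence of d_A nor that of the Lie derivative is needed. *)
Lemma alternating_dA (L : lie_algebroid A) (k : nat) (w : Aform A k) (x : M) :
  alternating (dA L w x).
Proof.
rewrite /dA /the_or; case: pselect => [h|_]; last exact: alternating0.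
by have [[]] := projT2 (cid h).
Qed.

Lemma alternating_lie_derivative (L : lie_algebroid A) (X : section A) (k : nat)
    (P : multisection A k) (x : M) :
  is_multisection P -> alternating (lie_derivative L X P x).
Proof.
move=> PM; rewrite /lie_derivative /the_or.
case: pselect => [h|_]; last exact: alternating0.
by have [/(_ _ _ PM)[]] := projT2 (cid h).
Qed.

End Sections.

(* The degree n >= 2 of the multisection is written [k.+1] with [1 <= k]. *)
Theorem proposition3p11 (R : realType) (m r : nat) (M : manifold R m)
    (A : vector_bundle M r) (L : lie_algebroid A)
    (k : nat) (hk : (1 <= k)%N) (Pi : multisection A k.+1)
    (hPi : is_multisection Pi) (hdec : locally_decomposable Pi) :
  (forall alpha : Aform A k, is_form alpha ->
     forall x a,
       lie_derivative L (sharp Pi alpha) Pi x a =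
       (-1) ^+ k.+1 * full_contract (dA L alpha x) (Pi x) * Pi x a)
  <->
  (forall alpha beta : Aform A k, is_form alpha -> is_form beta ->
     forall x,
       sharp (lie_derivative L (sharp Pi alpha) Pi) beta x =
       - sharp Pi (fun y => insert (sharp Pi beta y) (dA L alpha y)) x).
Proof.
have dec x : (forall a, Pi x a = 0) \/ (exists X, Pi x = decomposable_vec X).
  have [?|[U [X [_ Ux _ PiX]]]] := hdec x; [by left|right].
  by exists (fun i => X i x); apply/funext; exact: PiX.
pose c (alpha : Aform A k) x :=
  (-1) ^+ k.+1 * full_contract (dA L alpha x) (Pi x).
(* The sign (-1)^k of [sharp_insert_sharp] and the minus sign of the second condition combine into
   the (-1)^(k+1) of the first. *)
have rhsE (alpha beta : Aform A k) x : is_form beta ->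
    - sharp Pi (fun y => insert (sharp Pi beta y) (dA L alpha y)) x =
    c alpha x *: sharp Pi beta x.
  move=> bF; rewrite /sharp sharp_insert_sharp //.
  - by rewrite -scaleNr /c exprS mulN1r mulNr.
  - exact: alternating_dA.
  - exact: bF.1.
split=> [H1 alpha beta aF bF x|H2 alpha aF x a].
  rewrite rhsE // /sharp.
  rewrite (_ : lie_derivative _ _ _ _ = fun a => c alpha x * Pi x a + 0).
    by rewrite vec_of_contract_linear [X in _ + X]vec_of_contract0 // addr0.
  by apply/funext=> a; rewrite H1 // addr0.
have [e fe ex] := frame_cover A x.
(* The defect of the first condition at [x]; the contractions of [T] by wedges of frame covectors
   are shown to vanish. *)
pose T a := - c alpha x * Pi x a + lie_derivative L (sharp Pi alpha) Pi x a.
suff T0 : T a = 0.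
  by apply/eqP; rewrite -subr_eq0 addrC -mulNr; apply/eqP.
apply: (alternating_eq0 (frame_basis fe ex)) => [|i].
  by apply: alternating_linear; [exact: hPi.1|exact: alternating_lie_derivative].
(* The second condition only speaks of global forms, so the basis form at [x] is reached through a
   global [beta], up to the nonzero factor [b]. *)
have [beta [b [bF b0 bx]]] := form_through_coframe i fe ex.
have /eqP := H2 alpha beta aF bF x; rewrite rhsE // -subr_eq0 addrC -scaleNr.
rewrite /sharp -vec_of_contract_linear bx vec_of_contractZl scaler_eq0.
by rewrite (negbTE b0) => /eqP.
Qed.
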